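(* Let $m$ and $n$ be nonnegative integers with $m\le n$. Then $$\sum_{k=0}^{n-1}\frac{2^{2(n-k)}}{n-k}\,\frac{C_k}{\prod_{j=1}^m\bigl(2(k-j)+1\bigr)} = \frac{2^{m+1}}{m!\,\binom{n+1}{m}}\,C_{n-m}\,(O_{n-m}-O_{m+1})+\frac{(-1)^m2^{2n+m+2}}{(m+2)!\,(n+1)\,C_{m+1}}.$$
   Context: $C_n=\frac{1}{n+1}\binom{2n}{n}$, $n\ge 0$, are the Catalan numbers. $O_n=\sum_{k=1}^n\frac{1}{2k-1}$ are the odd harmonic numbers, with $O_0=0$. Empty sums equal $0$ and empty products equal $1$. *)

(* Defs.v *)
From mathcomp Require Import all_boot all_order all_algebra.
Set Implicit Arguments.
Unset Strict Implicit.
Unset Printing Implicit Defensive.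
Import Order.TTheory GRing.Theory Num.Theory.
Local Open Scope ring_scope.

Definition catalan (n : nat) : rat := 1 / (n + 1)%:R * 'C(2 * n, n)%:R.

Definition oddharm (n : nat) : rat :=
  \sum_(1 <= k < n.+1) 1 / (2 * k%:R - 1).

(* Main.v *)
(** Up to a constant depending on [m], the quotient of [catalan k / 4 ^ k] by
the product is the coefficient of [x ^ (k + 1)] in [(1 - x) ^ (m + 1/2)], so
the sum is a coefficient of [ln (1 - x) * ((1 - x) ^ (m + 1/2) - 1)].
Multiplication by [1 - x] then gives a recurrence in [m], with which the
closed form propagates from [m] to [m + 1]; for [m = 0], the first order
differential equation of [(1 - x) ^ (1/2) * ln (1 - x)] gives a recurrence in
[n]. *)

Require Import Defs.
From mathcomp Require Import all_boot all_order all_algebra.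
From mathcomp Require Import ring lra zify.
Set Implicit Arguments.
Unset Strict Implicit.
Unset Printing Implicit Defensive.
Import Order.TTheory GRing.Theory Num.Theory.
Local Open Scope ring_scope.

(* [field] normalizes its side conditions, so each is matched with a hypothesis only up to [ring] and sign. *)
Ltac nonzero :=
  lazymatch goal with
  | |- is_true (_ && _) => apply/andP; split; nonzero
  | |- _ =>
    match goal with
    | H : is_true (?a != _) |- is_true (?b != _) =>
      first [ exact: H
            | have -> : b = a by [ring]; exact: H
            | have -> : b = - a by [ring]; rewrite oppr_eq0; exact: H ]
    end
  end.

Definition oddprod (m k : nat) : rat :=
  \prod_(1 <= j < m.+1) (2 * (k%:R - j%:R) + 1).

(** The coefficient of [x ^ n] in [- ln (1 - 4 x)] times the generating function of [b]. *)
Definition wsum (b : nat -> rat) (n : nat) : rat :=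
  \sum_(0 <= k < n) 2 ^+ (2 * (n - k)) / (n - k)%:R * b k.

Lemma natr1_neq0 (n : nat) : n%:R + 1 != 0 :> rat.
Proof. by rewrite natr1 pnatr_eq0. Qed.

Lemma natr2_neq0 (n : nat) : n%:R + 2 != 0 :> rat.
Proof. by rewrite -(natrD _ n 2) addn2 pnatr_eq0. Qed.

Lemma odd_natr_neq0 (n : nat) : 2 * n%:R + 1 != 0 :> rat.
Proof. by rewrite -(natrM _ 2) natr1 pnatr_eq0. Qed.

Lemma odd_subr_neq0 (k j : nat) : 2 * (k%:R - j%:R) + 1 != 0 :> rat.
Proof.
apply/eqP => e.
have /eqP : (2 * k + 1)%:R = (2 * j)%:R :> rat by rewrite natrD !natrM; lra.
by rewrite eqr_nat => /eqP; lia.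
Qed.

Lemma natr_factS (n : nat) : (n.+1)`!%:R = n.+1%:R * n`!%:R :> rat.
Proof. by rewrite factS natrM. Qed.

Lemma catalan0 : catalan 0 = 1.
Proof. by rewrite /catalan muln0 bin0 add0n divr1 mulr1. Qed.

Lemma catalanS (n : nat) :
  catalan n.+1 = 2 * (2 * n%:R + 1) / (n%:R + 2) * catalan n.
Proof.
have e : (n.+1 * 'C(2 * n.+1, n.+1) = 2 * (2 * n + 1) * 'C(2 * n, n))%N.
  (* Both relations contain ['C(2 * n + 1, n)]; eliminating it links consecutive central
     binomials. *)
  have h1 := mul_bin_diag (2 * n).+2 n.
  have h2 := mul_bin_down (2 * n).+1 n.
  have -> : (2 * n.+1 = (2 * n).+2)%N by lia.
  move: h1 h2; rewrite /= (_ : (2 * n).+1 - n = n.+1)%N; last by lia.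
  nia.
have {e} : n.+1%:R * 'C(2 * n.+1, n.+1)%:R
    = 2 * (2 * n%:R + 1) * 'C(2 * n, n)%:R :> rat.
  by rewrite -!natrM e !natrM natrD natrM.
rewrite /catalan !addn1 -[n.+2%:R]/(1 + n.+1%:R) -natr1 => e.
have h1 := natr1_neq0 n; have h2 := natr2_neq0 n.
have -> : 'C(2 * n.+1, n.+1)%:R
    = 2 * (2 * n%:R + 1) * 'C(2 * n, n)%:R / (n%:R + 1) :> rat.
  by rewrite -e; field.
by field; rewrite h1 h2.
Qed.

Lemma catalan_neq0 (n : nat) : catalan n != 0.
Proof.
by rewrite /catalan !mulf_neq0 ?invr_eq0 ?pnatr_eq0 // ?addn1 // -lt0n
  bin_gt0; lia.
Qed.

Lemma oddharm0 : oddharm 0 = 0.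
Proof. by rewrite /oddharm big_geq. Qed.

Lemma oddharmS (n : nat) : oddharm n.+1 = oddharm n + (2 * n%:R + 1)^-1.
Proof.
rewrite /oddharm big_nat_recr //= -natr1 div1r; congr (_ + _^-1); ring.
Qed.

Lemma oddprod0 (k : nat) : oddprod 0 k = 1.
Proof. by rewrite /oddprod big_geq. Qed.

Lemma oddprodSl (m k : nat) :
  oddprod m.+1 k = oddprod m k * (2 * (k%:R - m%:R) - 1).
Proof.
rewrite /oddprod big_nat_recr //= -(natr1 m); congr (_ * _); ring.
Qed.

(** Raising [k] by one shifts the factors by one index, so both sides are the product over
    [0 <= j <= m]. *)
Lemma oddprodSr (m k : nat) :
  oddprod m k.+1 * (2 * (k%:R - m%:R) + 1) = oddprod m k * (2 * k%:R + 1).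
Proof.
elim: m => [|m IH]; first by rewrite !oddprod0 subr0.
transitivity ((oddprod m k.+1 * (2 * (k%:R - m%:R) + 1))
   * (2 * (k%:R - m%:R) - 1)); first by rewrite oddprodSl -!natr1; ring.
by rewrite IH oddprodSl; ring.
Qed.

Lemma oddprod_neq0 (m k : nat) : oddprod m k != 0.
Proof.
by rewrite /oddprod; apply: (big_ind (fun x : rat => x != 0)) => [//|x y|j _];
  [apply: mulf_neq0 | apply: odd_subr_neq0].
Qed.

Definition catquot (m k : nat) : rat := catalan k / oddprod m k.

(** Lowest coefficient of the multiplication by [1 - x]: the last summand is the constant term of
    [(1 - x) ^ (m + 1/2)], and [- (2 * m + 3)] is the ratio of the normalizing constants for [m + 1]
    and [m]. *)
Lemma catquot_rec0 (m : nat) :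
  - (2 * m%:R + 3) * catquot m.+1 0
  = catquot m 0 + 2 * catquot m 0 / (2 * m%:R + 1).
Proof.
have h1 := odd_natr_neq0 m; have h2 := oddprod_neq0 m 0.
by rewrite /catquot oddprodSl; field; nonzero.
Qed.

(** The higher coefficients of the same product; the [4] comes from the scaling by [4 ^ k]. *)
Lemma catquot_recS (m k : nat) :
  - (2 * m%:R + 3) * catquot m.+1 k.+1 = catquot m k.+1 - 4 * catquot m k.
Proof.
have h1 := odd_natr_neq0 k; have h2 := oddprod_neq0 m k.
have h3 := odd_subr_neq0 k m; have h4 := natr2_neq0 k.
rewrite /catquot catalanS oddprodSl -(natr1 k).
have -> : oddprod m k.+1 = oddprod m k * (2 * k%:R + 1) / (2 * (k%:R - m%:R) + 1).
  by rewrite -oddprodSr; field.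
by field; nonzero.
Qed.

Lemma wsum_recl (b : nat -> rat) (n : nat) :
  wsum b n.+1 = 2 ^+ (2 * n.+1) / n.+1%:R * b 0 + wsum (fun k => b k.+1) n.
Proof.
by rewrite /wsum big_nat_recl // subn0; under eq_bigr do rewrite subSS.
Qed.

Lemma wsum_catquotS (m n : nat) :
  - (2 * m%:R + 3) * wsum (catquot m.+1) n.+1
  = wsum (catquot m) n.+1 - 4 * wsum (catquot m) n
    + 2 ^+ (2 * n.+1) / n.+1%:R * (2 * catquot m 0 / (2 * m%:R + 1)).
Proof.
have tail : - (2 * m%:R + 3) * wsum (fun k => catquot m.+1 k.+1) n
    = wsum (fun k => catquot m k.+1) n - 4 * wsum (catquot m) n.
  rewrite /wsum !mulr_sumr -sumrB; apply: eq_bigr => k _.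
  by rewrite mulrCA catquot_recS; ring.
by rewrite !wsum_recl mulrDr tail mulrCA catquot_rec0; ring.
Qed.

(** Writing [n + 2 = (n + 1 - k) + (k + 1)] cancels a denominator in the first part and allows the
    Catalan recurrence in the second. After the index shift, [2 * (2 * k + 1) = (4 * n + 2) - 4 * (n
    - k)] restores [wsum catalan n]. The two sums [P] then differ by [4 * catalan n] alone. *)
Lemma wsum_catalanS (n : nat) :
  (n%:R + 2) * wsum catalan n.+1
  = (4 * n%:R + 2) * wsum catalan n + 4 * catalan n
    + 2 ^+ (2 * n.+1) / n.+1%:R.
Proof.
pose P N := \sum_(0 <= k < N) 2 ^+ (2 * (n.+1 - k)) * catalan k.
have split1 : (n%:R + 2) * wsum catalan n.+1
   = P n.+1 + wsum (fun k => (k%:R + 1) * catalan k) n.+1.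
  rewrite /wsum mulr_sumr -big_split /=; apply: eq_big_nat => k /andP[_ kn].
  have e : n%:R = (n.+1 - k)%:R + k%:R - 1 :> rat.
    by rewrite -natrD subnK 1?ltnW // -natr1; ring.
  have h : (n.+1 - k)%:R != 0 :> rat by rewrite pnatr_eq0 subn_eq0 -ltnNge.
  by rewrite e; field.
have split2 : wsum (fun k => 2 * (2 * k%:R + 1) * catalan k) n
   = (4 * n%:R + 2) * wsum catalan n - P n.
  rewrite /wsum mulr_sumr -sumrB /=; apply: eq_big_nat => k /andP[_ kn].
  have e : n%:R = (n - k)%:R + k%:R :> rat by rewrite -natrD subnK // ltnW.
  have h : (n - k)%:R != 0 :> rat by rewrite pnatr_eq0 subn_eq0 -ltnNge.
  rewrite (_ : 2 * (n.+1 - k) = (2 * (n - k)).+2)%N; last by lia.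
  by rewrite 2!exprS e; field.
have shift : wsum (fun k => (k%:R + 1) * catalan k) n.+1
   = 2 ^+ (2 * n.+1) / n.+1%:R
     + wsum (fun k => 2 * (2 * k%:R + 1) * catalan k) n.
  rewrite wsum_recl catalan0 add0r !mulr1; congr (_ + _).
  apply: eq_bigr => k _; rewrite catalanS -natr1; congr (_ * _).
  by have h := natr2_neq0 k; field.
rewrite split1 shift split2 /P big_nat_recr //= subSnn; ring.
Qed.

Lemma wsum_catalan (n : nat) :
  wsum catalan n
  = 2 * catalan n * (oddharm n - 1) + 2 * 2 ^+ (2 * n) / (n%:R + 1).
Proof.
elim: n => [|n IH].
  by rewrite /wsum big_geq // catalan0 oddharm0; field.
have h1 := natr1_neq0 n; have h2 := natr2_neq0 n; have h3 := odd_natr_neq0 n.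
apply: (mulfI h2); rewrite wsum_catalanS IH catalanS oddharmS mulnS exprD.
by rewrite -!natr1; field; nonzero.
Qed.

(** Here [d] stands for [n - m], which removes truncated subtraction from the induction. *)
Definition harmcoef (m d : nat) : rat :=
  2 ^+ (m + 1) / ((m`!)%:R * 'C(m + d + 1, m)%:R) * catalan d.

(** In factorial form, a step in [m] or in [d] is a ratio of consecutive terms. *)
Lemma harmcoefE (m d : nat) :
  harmcoef m d = 2 ^+ m.+1 * (d.+1)`!%:R / (m + d).+1`!%:R * catalan d.
Proof.
have hb : ('C((m + d).+1, m) * (m`! * (d.+1)`!) = (m + d).+1`!)%N.
  by rewrite -addnS -[in (d.+1)`!](addKn m d.+1) bin_fact // leq_addr.
have h1 : (m`!)%:R != 0 :> rat by rewrite pnatr_eq0 -lt0n fact_gt0.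
have h2 : ((d.+1)`!)%:R != 0 :> rat by rewrite pnatr_eq0 -lt0n fact_gt0.
have h3 : 'C((m + d).+1, m)%:R != 0 :> rat.
  by rewrite pnatr_eq0 -lt0n bin_gt0 leqW ?leq_addr.
have <- : 'C((m + d).+1, m)%:R * (m`!%:R * (d.+1)`!%:R) = (m + d).+1`!%:R :> rat.
  by rewrite -hb (natrM _ 'C(_, _)) (natrM _ m`!).
by rewrite /harmcoef !addn1; move: (d.+1)`!%:R h2 => f h2; field; nonzero.
Qed.

Lemma harmcoefSl (m d : nat) :
  harmcoef m.+1 d = 2 / ((m + d)%:R + 2) * harmcoef m d.
Proof.
have h := natr2_neq0 (m + d).
have h1 : ((m + d).+1`!)%:R != 0 :> rat by rewrite pnatr_eq0 -lt0n fact_gt0.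
rewrite !harmcoefE addSn exprS (natr_factS (m + d).+1).
by field; nonzero.
Qed.

Lemma harmcoefSr (m d : nat) :
  harmcoef m d.+1 = 2 * (2 * d%:R + 1) / ((m + d)%:R + 2) * harmcoef m d.
Proof.
have h := natr2_neq0 (m + d); have h2 := natr2_neq0 d.
have h1 : ((m + d).+1`!)%:R != 0 :> rat by rewrite pnatr_eq0 -lt0n fact_gt0.
rewrite !harmcoefE catalanS addnS (natr_factS (m + d).+1).
rewrite (natr_factS d.+1); move: (m + d).+1`!%:R h1 => f h1.
by field; nonzero.
Qed.

(** Up to the factor [4 ^ n / (n + 1)], the contribution of the [- 1] in
    [(1 - x) ^ (m + 1/2) - 1]. *)
Definition tailcoef (m : nat) : rat :=
  (-1) ^+ m * 2 ^+ (m + 2) / (((m + 2)`!)%:R * catalan (m + 1)).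

Lemma tailcoefS (m : nat) :
  tailcoef m.+1 * (2 * m%:R + 3) = - tailcoef m.
Proof.
have h1 : ((m.+2)`!)%:R != 0 :> rat by rewrite pnatr_eq0 -lt0n fact_gt0.
have h2 := catalan_neq0 m.+1; have h3 := odd_natr_neq0 m.+1.
have h4 := natr2_neq0 m.+1; rewrite -natr1 in h3 h4.
rewrite /tailcoef !addn2 !addn1 (catalanS m.+1) (natr_factS m.+2) !exprS.
by field; nonzero.
Qed.

(** Both sides obey the recurrence [tailcoefS]; this recognizes the boundary term of
    [wsum_catquotS]. *)
Lemma tailcoefE (m : nat) : tailcoef m = 2 * catquot m 0 / (2 * m%:R + 1).
Proof.
elim: m => [|m IH].
  by rewrite /tailcoef /catquot oddprod0 catalanS catalan0.
have h' : 2 * m%:R + 3 != 0 :> rat.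
  by rewrite (_ : _ + 3 = 2 * m.+1%:R + 1) ?odd_natr_neq0 //; ring.
have h1 := odd_natr_neq0 m; have h2 := oddprod_neq0 m 0.
apply: (mulIf h'); rewrite tailcoefS IH /catquot oddprodSl.
by field; nonzero.
Qed.

(** Induction on [m] for all [d] at once: the case [m + 1] at [d] calls on the case [m] at both
    [d + 1] and [d]. *)
Lemma wsum_catquot (m d : nat) :
  wsum (catquot m) (m + d)
  = harmcoef m d * (oddharm d - oddharm m.+1)
    + tailcoef m * 2 ^+ (2 * (m + d)) / ((m + d)%:R + 1).
Proof.
elim: m d => [|m IH] d.
  rewrite /wsum; under eq_bigr do rewrite /catquot oddprod0 divr1.
  rewrite -/(wsum catalan d) wsum_catalan oddharmS oddharm0 /harmcoef /tailcoef.
  rewrite bin0 catalanS catalan0 !add0n (_ : 2`! = 2)%N; last by [].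
  rewrite fact0 expr0 expr1 !mulr0 !add0r.
  by have h := natr1_neq0 d; field; nonzero.
have h : - (2 * m%:R + 3) != 0 :> rat.
  rewrite oppr_eq0 (_ : _ + 3 = 2 * m.+1%:R + 1) ?odd_natr_neq0 // -natr1; ring.
have h1 := natr1_neq0 (m + d); have h2 := natr2_neq0 (m + d).
have h3 := odd_natr_neq0 d; have h4 := odd_natr_neq0 m.
apply: (mulfI h); rewrite addSn wsum_catquotS -tailcoefE -addnS !IH.
have tS : tailcoef m.+1 = tailcoef m / - (2 * m%:R + 3).
  by rewrite -[X in X / _]opprK -tailcoefS; field; rewrite -oppr_eq0 h.
(* Everything is reduced to [harmcoef m d], [tailcoef m], [oddharm d] and [oddharm m], leaving a
   rational identity. *)
rewrite tS harmcoefSl harmcoefSr !oddharmS addnS mulnS exprD -!natr1 natrD.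
rewrite natrD in h1 h2; rewrite oppr_eq0 in h.
by field; nonzero.
Qed.

Theorem proposition6 (m n : nat) (hmn : (m <= n)%N) :
  \sum_(0 <= k < n)
     2 ^+ (2 * (n - k)) / (n - k)%:R
     * (catalan k / \prod_(1 <= j < m.+1) (2 * (k%:R - j%:R) + 1))
  = 2 ^+ (m + 1) / ((m`!)%:R * 'C(n + 1, m)%:R)
      * catalan (n - m) * (oddharm (n - m) - oddharm (m + 1))
    + (-1) ^+ m * 2 ^+ (2 * n + m + 2)
      / (((m + 2)`!)%:R * (n + 1)%:R * catalan (m + 1)) :> rat.
Proof.
rewrite -(subnKC hmn); move: (n - m)%N => d; rewrite addKn.
rewrite -[LHS]/(wsum (catquot m) (m + d)) wsum_catquot /harmcoef.
rewrite !addn1; congr (_ + _).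
have h1 := natr1_neq0 (m + d); have h2 := catalan_neq0 m.+1.
have h3 : ((m + 2)`!)%:R != 0 :> rat by rewrite pnatr_eq0 -lt0n fact_gt0.
rewrite (_ : 2 * (m + d) + m + 2 = m + 2 + 2 * (m + d))%N; last by lia.
rewrite /tailcoef addn1 [2 ^+ (m + 2 + _)]exprD -(natr1 (m + d)).
by move: (2 ^+ (m + 2)) (2 ^+ (2 * (m + d))) => p q; field; nonzero.
Qed.
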